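(* Let $R>0$ and let $S\subset\mathbb{R}^3$ be the surface with square base of side $2R$ and height $R$ described in the context. For every vertical plane $\Pi$ through the origin (that is, every plane in $\mathbb{R}^3$ containing the $z$-axis), the curve of intersection $S\cap\Pi$ is elliptic, i.e. it is an arc of an ellipse lying in $\Pi$ (a circle being regarded as a special case of an ellipse).
   Context: Let $P=[-R,R]^2$ be the square of side $2R$ in the $xy$-plane centred at the origin. Consider the cuboid $C=P\times[0,R]$ and the inverted pyramid inside it with apex at the origin and base the top face $P\times\{R\}$, whose section at height $z\in[0,R]$ is the square $\frac{z}{R}P$. The cuboid with the pyramid removed is cut by planes parallel to the $xy$-plane into $m$ slices of equal thickness. Each slice is replaced by a slab of the same thickness and the same volume, whose horizontal cross-section is a square concentric with and homothetic to $P$ (with centre on the $z$-axis). The slabs are stacked in the same order, and the surface $S$ is the lateral surface of the limiting solid as $m\to\infty$. Explicitly, for each $z\in[0,R]$ the section of $S$ at height $z$ is the boundary of the square $\lambda(z)P$, with $\lambda(z)\ge 0$ determined by the equality of areas $\operatorname{area}(\lambda(z)P)=\operatorname{area}(P)-\operatorname{area}\left(\frac{z}{R}P\right)$. At $z=R$ the section is the single point $(0,0,R)$. *)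

(* Defs.v *)
From mathcomp Require Import all_boot all_order all_algebra.
From mathcomp Require Import all_classical all_reals all_analysis.

Set Implicit Arguments.
Unset Strict Implicit.
Unset Printing Implicit Defensive.

Import Order.TTheory GRing.Theory Num.Theory.
Import numFieldNormedType.Exports.

Local Open Scope classical_set_scope.
Local Open Scope ring_scope.

Section Defs.
Variable R : realType.

Definition area (A : set (R * R)) : \bar R :=
  ((@lebesgue_measure R) \x (@lebesgue_measure R))%E A.

Definition square (r : R) : set (R * R) := `[- r, r] `*` `[- r, r].

Definition dilate (k : R) (A : set (R * R)) : set (R * R) :=
  [set (k * q.1, k * q.2) | q in A].

Definition boundary (T : topologicalType) (A : set T) : set T :=
  closure A `\` interior A.

(* At each height the equality of areas has exactly one solution k >= 0, so
   the existential below selects the factor lambda(z). At height r it is 0, and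
   the section is the boundary of a one-point set, which is that point. *)
Definition surface (r : R) : set 'rV[R]_3 :=
  [set p | let z := p 0 2%:R in
    0 <= z <= r /\
    exists k : R, [/\ 0 <= k,
      area (dilate k (square r)) =
        (area (square r) - area (dilate (z / r) (square r)))%E &
      boundary (dilate k (square r)) (p 0 0, p 0 1)]].

Definition dot (u v : 'rV[R]_3) : R := (u *m v^T) 0 0.

Definition is_plane (Pi : set 'rV[R]_3) : Prop :=
  exists (n : 'rV[R]_3) (d : R), n != 0 /\ Pi = [set p | dot n p = d].

Definition z_axis : set 'rV[R]_3 := [set p | p 0 0 = 0 /\ p 0 1 = 0].

(* For u, v orthonormal and a, b > 0 the range is the ellipse with centre c,
   axes along u and v and semi-axes a and b; it is a circle when a = b. *)
Definition ellipse_param (c u v : 'rV[R]_3) (a b t : R) : 'rV[R]_3 :=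
  c + (a * cos t) *: u + (b * sin t) *: v.

(* s < t excludes one-point arcs; t = s + 2 pi gives the whole ellipse. *)
Definition is_elliptic_arc_in (Pi A : set 'rV[R]_3) : Prop :=
  exists (c u v : 'rV[R]_3) (a b s t : R),
    [/\ [/\ dot u u = 1, dot v v = 1 & dot u v = 0],
        0 < a /\ 0 < b,
        range (ellipse_param c u v a b) `<=` Pi,
        s < t <= s + 2 * pi &
        A = ellipse_param c u v a b @` `[s, t]].

End Defs.

(* Main.v *)
(* The equality of areas says that the section of S at height z is the set of
   points with max(|x|, |y|) = sqrt(r^2 - z^2). In the vertical plane spanned by
   the z-axis and the horizontal unit vector (x, y), with horizontal coordinate
   k, this reads (m k)^2 + z^2 = r^2 with 0 <= z and m = max(|x|, |y|): the
   upper half of an ellipse with semi-axes r / m and r. *)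
Require Import Defs.
From mathcomp Require Import all_boot all_order all_algebra.
From mathcomp Require Import all_classical all_reals all_analysis.
From mathcomp Require Import ring lra.

Import Order.TTheory GRing.Theory Num.Theory.
Import numFieldNormedType.Exports.
Local Open Scope classical_set_scope.
Local Open Scope ring_scope.

Lemma interior_setX {T U : topologicalType} (A : set T) (B : set U) :
  (A `*` B)° = A° `*` B°.
Proof.
apply/seteqP; split => -[x y].
- move=> [[C D] /= [Cx Dy] CDAB]; split => /=.
  + apply: filterS Cx => x' Cx'.
    by have [] := CDAB (x', y) (conj Cx' (nbhs_singleton Dy)).
  + apply: filterS Dy => y' Dy'.
    by have [] := CDAB (x, y') (conj (nbhs_singleton Cx) Dy').
- by move=> [/= Ax By]; exists (A, B).
Qed.

Lemma closed_setX {T U : topologicalType} (A : set T) (B : set U) :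
  closed A -> closed B -> closed (A `*` B).
Proof.
move=> cA cB; have -> : A `*` B = (fst @^-1` A) `&` (snd @^-1` B) by [].
apply: closedI.
- by apply: preimage_closed => // x _; exact: cvg_fst.
- by apply: preimage_closed => // x _; exact: cvg_snd.
Qed.

(** A point of the closed square is outside the open one exactly when a bound is attained. At
    [s = 0] the open square is empty and the boundary is the origin, which covers the apex of the
    surface. *)
Lemma boundary_square {R : realType} (s : R) (q : R * R) :
  boundary (square s) q <-> Num.max `|q.1| `|q.2| = s.
Proof.
rewrite /boundary /square.
rewrite -(closure_id _).1; last by apply: closed_setX; exact: itv_closed.
rewrite interior_setX !interior_itv; case: q => x y /=.
rewrite /setX /setD /= !in_itv /= -!ler_norml -!ltr_norml.
split.
- move=> [[xs ys] /not_andP xys]; apply/le_anti; rewrite ge_max xs ys /= le_max.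
  by case: xys => /negP; rewrite -leNgt => ->; rewrite ?orbT.
- move=> <-; split; first by rewrite !le_max !lexx orbT.
  by apply/not_andP; case: (leP `|x| `|y|) => h; [right|left]; rewrite ltxx.
Qed.

Lemma dilate_square {R : realType} (k r : R) : 0 < r -> 0 <= k ->
  dilate k (square r) = square (k * r).
Proof.
move=> r0 k0; apply/seteqP; split => -[x y].
- move=> [[a b] [/=]]; rewrite !in_itv /= -!ler_norml => ar br [<- <-].
  by split; rewrite /= in_itv /= -ler_norml normrM (ger0_norm k0) ler_wpM2l.
- move=> [/=]; rewrite !in_itv /= -!ler_norml.
  (* A preimage is found by scaling with [k^-1]; for [k = 0] both sets reduce to the origin. *)
  have [->|kn0] := eqVneq k 0.
    rewrite mul0r !normr_le0 => /eqP -> /eqP ->.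
    exists (0, 0); last by rewrite /= !mulr0.
    by split; rewrite /= in_itv /= -ler_norml normr0 ltW.
  have kp : 0 < k by rewrite lt_def kn0.
  move=> xr yr; exists (k^-1 * x, k^-1 * y); last by rewrite /= !mulVKf.
  by split; rewrite /= in_itv /= -ler_norml normrM gtr0_norm ?invr_gt0 //
     ler_pdivrMl.
Qed.

Lemma area_square {R : realType} (s : R) : 0 <= s ->
  area (square s) = ((2 * s) ^+ 2)%:E.
Proof.
move=> s0; rewrite /area /square product_measure1E //=.
have -> : lebesgue_measure `[- s, s] = (2 * s)%:E.
  (* The interval formula gives 0 unless [- s < s]; the remaining case is [s = 0]. *)
  rewrite lebesgue_measure_itv /= lte_fin; case: ifPn => [_|].
    by rewrite -EFinD opprK mulrDl mul1r.
  by rewrite -leNgt => ss; congr EFin; lra.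
by rewrite -EFinM expr2.
Qed.

(** Divided by 4, the equality of areas is [(k * r) ^+ 2 + z ^+ 2 = r ^+ 2]. The boundary condition
    says that [k * r] is the max norm of the horizontal part, which eliminates [k]. *)
Lemma surfaceP {R : realType} (r : R) (p : 'rV[R]_3) : 0 < r ->
  surface r p <->
  0 <= p 0 2%:R <= r /\
  (Num.max `|p 0 0| `|p 0 1|) ^+ 2 + p 0 2%:R ^+ 2 = r ^+ 2.
Proof.
move=> r0; rewrite /surface /=; set z := p 0 2%:R; set m := Num.max _ _.
have areaE k : 0 <= k -> 0 <= z ->
  (area (dilate k (square r)) =
    (area (square r) - area (dilate (z / r) (square r)))%E) <->
  (k * r) ^+ 2 + z ^+ 2 = r ^+ 2.
  move=> k0 z0; have zr0 : 0 <= z / r by rewrite divr_ge0 // ltW.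
  rewrite !dilate_square // !area_square ?(mulr_ge0, invr_ge0, ltW r0) //.
  rewrite divfK ?gt_eqF // -EFinB; split => [[] h|h]; first by lra.
  by congr EFin; lra.
split => -[/andP[z0 zr]].
- move=> [k [k0 /(areaE k k0 z0) kE]].
  by rewrite dilate_square // boundary_square /= -/m => ->; rewrite z0 zr.
- move=> mE; rewrite z0 zr; split => //; exists (m / r).
  have k0 : 0 <= m / r by rewrite divr_ge0 ?(ltW r0) // le_max normr_ge0.
  split => //; first by apply/areaE; rewrite ?divfK ?gt_eqF.
  by rewrite dilate_square // boundary_square divfK ?gt_eqF.
Qed.

Lemma dot3E {R : realType} (u v : 'rV[R]_3) :
  dot u v = u 0 0 * v 0 0 + u 0 1 * v 0 1 + u 0 2%:R * v 0 2%:R.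
Proof.
rewrite /dot mxE !big_ord_recl big_ord0 addr0 !mxE addrA.
(* The expanded sum has indices built by [lift], equal in value to the numerals. *)
by congr (_ * _ + _ * _ + _ * _); congr (_ _ _); apply: val_inj.
Qed.

Lemma eq_rV3 {R : realType} (u v : 'rV[R]_3) :
  u 0 0 = v 0 0 -> u 0 1 = v 0 1 -> u 0 2%:R = v 0 2%:R -> u = v.
Proof.
move=> h0 h1 h2; apply/rowP => -[[|[|[|//]]] i].
- by rewrite (_ : Ordinal i = 0) //; apply: val_inj.
- by rewrite (_ : Ordinal i = 1) //; apply: val_inj.
- by rewrite (_ : Ordinal i = 2%:R) //; apply: val_inj.
Qed.

Definition vec3 {R : realType} (a b c : R) : 'rV[R]_3 :=
  \row_j [:: a; b; c]`_j.

Lemma vec3E {R : realType} (a b c : R) :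
  (vec3 a b c 0 0 = a) * (vec3 a b c 0 1 = b) * (vec3 a b c 0 2%:R = c).
Proof. by rewrite !mxE. Qed.

(** The origin lies in the plane, so [d = 0]; then (0, 0, 1) forces the normal to be horizontal. The
    pair (x, y) is a horizontal unit direction of the plane. *)
Lemma vertical_planeP {R : realType} (Pi : set 'rV[R]_3) :
  is_plane Pi -> @z_axis R `<=` Pi ->
  exists x y : R, x ^+ 2 + y ^+ 2 = 1 /\
    Pi = [set p | p 0 0 * y = p 0 1 * x].
Proof.
move=> [n [d [n0 ->]]] zPi.
have d0 : d = 0.
  have := zPi (vec3 0 0 0); rewrite /z_axis /= dot3E !vec3E !mulr0 !addr0.
  by move=> ->.
have n2 : n 0 2%:R = 0.
  have := zPi (vec3 0 0 1); rewrite /z_axis /= dot3E !vec3E d0.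
  by rewrite !mulr0 !add0r mulr1; exact.
pose N := n 0 0 ^+ 2 + n 0 1 ^+ 2.
have N0 : 0 < N.
  rewrite lt_def addr_ge0 ?sqr_ge0 // andbT; apply: contraNneq n0 => /eqP.
  rewrite paddr_eq0 ?sqr_ge0 // !sqrf_eq0 => /andP[/eqP n00 /eqP n01].
  by apply/eqP/eq_rV3; rewrite ?n00 ?n01 ?n2 !mxE.
have s0 : Num.sqrt N != 0 by rewrite gt_eqF // sqrtr_gt0.
have sE : Num.sqrt N ^+ 2 = N by rewrite sqr_sqrtr // ltW.
(* The normal turned by a quarter turn and normalised. *)
exists (n 0 1 / Num.sqrt N), (- n 0 0 / Num.sqrt N); split.
  by rewrite !expr_div_n sE -mulrDl sqrrN addrC divff // gt_eqF.
apply/seteqP; split => p /=; rewrite dot3E d0 n2 mul0r addr0 !mulrA => h.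
  by congr (_ / _); lra.
by move/(mulIf (invr_neq0 s0)): h; lra.
Qed.

(** The angle is [acos x], whose sine is the nonnegative root of [1 - x ^+ 2]; the sign of [y] makes
    this root [y]. *)
Lemma upper_unit_circleP {R : realType} (x y : R) :
  0 <= y -> x ^+ 2 + y ^+ 2 = 1 ->
  exists2 t, 0 <= t <= pi & cos t = x /\ sin t = y.
Proof.
move=> y0 xy; have x1 : -1 <= x <= 1.
  by rewrite -ler_norml -(@expr_le1 _ 2) // real_normK ?num_real //; nra.
exists (acos x); first by rewrite acos_ge0 ?acos_lepi.
split; first by rewrite acosK // in_itv.
by rewrite sin_acos // -xy addrAC subrr add0r sqrtr_sqr ger0_norm.
Qed.

Theorem theorem3p1 (R : realType) (r : R) (hr : 0 < r)
    (Pi : set 'rV[R]_3) (hPi : is_plane Pi) (hz : @z_axis R `<=` Pi) :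
  is_elliptic_arc_in Pi (surface r `&` Pi).
Proof.
have [x [y [xy1 ->]]] := vertical_planeP _ hPi hz.
pose m := Num.max `|x| `|y|.
have m0 : 0 < m.
  rewrite lt_max !normr_gt0; apply: contra_eqT xy1.
  rewrite negb_or !negbK => /andP[/eqP-> /eqP->].
  by rewrite expr0n addr0 eq_sym oner_eq0.
have mn0 : m != 0 by rewrite gt_eqF.
have rn0 : r != 0 by rewrite gt_eqF.
have maxE k : Num.max `|k * x| `|k * y| = `|k| * m.
  by rewrite !normrM maxr_pMr.
pose c : 'rV[R]_3 := 0.
pose u := vec3 x y 0; pose v := vec3 (0 : R) 0 1.
have eE t : ellipse_param c u v (r / m) r t =
    vec3 (r / m * cos t * x) (r / m * cos t * y) (r * sin t).
  by apply: eq_rV3; rewrite /ellipse_param mxE [X in X + _]mxE !(mxE, vec3E);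
     rewrite /=; ring.
(* The angles from 0 to [pi] select the half of the ellipse with nonnegative height. *)
exists c, u, v, (r / m), r, 0, pi; split.
- by rewrite !dot3E !vec3E; split; lra.
- by rewrite divr_gt0.
- by move=> _ [t _ <-]; rewrite eE /= !vec3E; ring.
- by rewrite pi_gt0 /= add0r; have := pi_gt0 R; lra.
apply/seteqP; split => p.
- move=> [/(surfaceP _ _ hr) [/andP[z0 zr] sE] /= pPi].
  (* The coordinate along the unit vector (x, y); since [p] is in the plane, its horizontal part is
     [k] times that vector. *)
  pose k := p 0 0 * x + p 0 1 * y.
  have p0 : p 0 0 = k * x.
    have -> : k * x = p 0 0 * x ^+ 2 + p 0 1 * x * y by rewrite /k; ring.
    by rewrite -pPi -[LHS]mulr1 -xy1; ring.
  have p1 : p 0 1 = k * y.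
    have -> : k * y = p 0 0 * y * x + p 0 1 * y ^+ 2 by rewrite /k; ring.
    by rewrite pPi -[LHS]mulr1 -xy1; ring.
  move: sE; rewrite p0 p1 maxE exprMn real_normK ?num_real // => sE.
  (* Rescaling each axis by its semi-axis maps the ellipse to the unit circle. *)
  have [||t t0pi [ct st]] := @upper_unit_circleP R (k * m / r) (p 0 2%:R / r).
  + by rewrite divr_ge0 // ltW.
  + by rewrite !expr_div_n -mulrDl exprMn sE divff // expf_neq0.
  exists t; first by rewrite /= in_itv.
  by rewrite eE ct st; apply: eq_rV3;
     rewrite !vec3E ?p0 ?p1; field; rewrite ?mn0 ?rn0.
- move=> [t]; rewrite /= in_itv /= => /sin_ge0_pi st <-; rewrite eE.
  split; last by rewrite /= !vec3E; ring.
  apply/(surfaceP _ _ hr); rewrite !vec3E maxE; split.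
    by rewrite mulr_ge0 ?(ltW hr) //= ler_piMr ?(ltW hr) // sin_le1.
  rewrite exprMn real_normK ?num_real // -exprMn.
  have -> : r / m * cos t * m = r * cos t by field.
  by rewrite !exprMn -mulrDr cos2Dsin2 mulr1.
Qed.
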